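(* Let $a>0$ and $b\in\mathbb{R}$ be such that $$a\ge 2b\ge 0\qquad\text{or}\qquad a\ge -nb\ge 0,$$ let $\{v_1,\ldots,v_n\}$ be an $(a,b)$-equiangular basis of $\mathbb{R}^n$, and let $\Lambda_{a,b}$ be the lattice generated by $v_1,\ldots,v_n$. (i) For every $i\in\{1,\ldots,n\}$, we have $\lambda_i(B_n,\Lambda_{a,b})=\sqrt a$. (ii) For $j\in\{1,\ldots,n-1\}$, let $L_j=\mathrm{lin}\{v_1,\ldots,v_j\}$. Then $$\lambda_i(B_n|L_j^\perp,\Lambda_{a,b}|L_j^\perp)=\sqrt{\frac{(a-b)(a+bj)}{a+b(j-1)}}$$ for every $i\in\{1,\ldots,n-j\}$.
   Context: A basis $\{v_1,\ldots,v_n\}$ of $\mathbb{R}^n$ is $(a,b)$-equiangular if $\langle v_k,v_k\rangle=a$ for all $k$ and $\langle v_k,v_\ell\rangle=b$ for all $k\ne\ell$. $B_n=\{x\in\mathbb{R}^n:\|x\|\le1\}$ is the Euclidean unit ball; $\mathrm{lin}$ denotes linear hull; $\cdot|L^\perp$ denotes orthogonal projection onto $L^\perp$. Successive minima: for an origin-symmetric convex body $M$ (compact, convex, non-empty interior, $M=-M$) and a full-dimensional lattice $\Lambda$ in a $d$-dimensional Euclidean space, $\lambda_i(M,\Lambda)=\min\{\lambda>0:\dim(\lambda M\cap\Lambda)\ge i\}$, $1\le i\le d$, where $\dim$ of a set is the dimension of its affine hull. In (ii), they are taken in the $(n-j)$-dimensional Euclidean space $L_j^\perp$. *)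

(* Defs.v *)
From HB Require Import structures.
From mathcomp Require Import all_boot all_order all_algebra.
From mathcomp Require Import boolp classical_sets reals.

Set Implicit Arguments.
Unset Strict Implicit.
Unset Printing Implicit Defensive.

Import Order.TTheory GRing.Theory Num.Theory.

Local Open Scope ring_scope.
Local Open Scope classical_set_scope.

Section EuclideanSpace.
Context {R : realType} {n : nat}.
Implicit Types (u v w : 'rV[R]_n) (L W : {vspace 'rV[R]_n}).

(* MathComp-Analysis norms 'rV[R]_n by the sup norm; the Euclidean structure is
   given by this inner product instead. *)
Definition inner u v : R := \sum_(k < n) u 0 k * v 0 k.

Lemma inner_bilinear : bilinear_for *%R (idfun \; *%R) inner.
Proof.
split=> w c u v; rewrite /inner /= mulr_sumr -big_split /=; apply: eq_bigr => k _.
  by rewrite !mxE mulrDl mulrA.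
by rewrite !mxE mulrDr mulrCA.
Qed.

HB.instance Definition _ :=
  bilinear_isBilinear.Build R 'rV[R]_n 'rV[R]_n R _ _ inner inner_bilinear.

Lemma inner_hermitian u v : inner u v = (-1) ^+ false * idfun (inner v u).
Proof. by rewrite mul1r; apply: eq_bigr => k _; rewrite mulrC. Qed.

HB.instance Definition _ :=
  isHermitianSesquilinear.Build R 'rV[R]_n false idfun inner inner_hermitian.

Lemma inner_gt0 u : u != 0 -> 0 < inner u u.
Proof.
case/rV0Pn=> k uk_neq0; rewrite /inner (bigD1 k) //=.
rewrite ltr_pwDl ?sumr_ge0 // => [|i _]; last by rewrite -expr2 sqr_ge0.
by rewrite -expr2 exprn_even_gt0.
Qed.

HB.instance Definition _ := isDotProduct.Build R 'rV[R]_n inner inner_gt0.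

Definition enorm u : R := Num.sqrt (inner u u).

Definition unit_ball : set 'rV[R]_n := [set x | enorm x <= 1].

Definition perp L : {vspace 'rV[R]_n} := orthov inner L.

Definition orth_proj W : 'End('rV[R]_n) :=
  daddv_pi W (perp W).

Lemma perp_disjoint W : (W :&: perp W = 0)%VS.
Proof.
apply/eqP; rewrite -subv0; apply/subvP => u; rewrite memv_cap memv0.
case/andP=> uW /mem_orthovP/(_ u uW)/eqP; apply: contraTT => /inner_gt0.
by rewrite lt0r => /andP[].
Qed.

Lemma perp_full W : (W + perp W = fullv)%VS.
Proof.
apply/eqP; rewrite eqEdim subvf /= dimv_disjoint_sum ?perp_disjoint //.
pose T u : 'rV[R]_(\dim W) := \row_i inner u (vbasis W)`_i.
have T_lin : linear T.
  by move=> c u w; apply/rowP => i; rewrite !mxE linearDl /= linearZl_LR.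
pose T' := GRing.isLinear.Build R _ _ _ T T_lin.
pose Tl : {linear 'rV[R]_n -> 'rV[R]_(\dim W)} := HB.pack T T'.
rewrite -(limg_ker_dim (linfun Tl) fullv) capfv addnC leq_add //.
  by rewrite (leq_trans (dimvS (subvf _))) // dimvf /dim /= mul1n.
apply/dimvS/subvP => u; rewrite memv_ker lfunE => /eqP Tu.
apply/mem_orthovP => w /coord_vbasis ->; rewrite linear_sumr big1 // => i _.
by have /rowP/(_ i) := Tu; rewrite !mxE linearZr_LR /= => ->; rewrite mulr0.
Qed.

Lemma orth_projP W u :
  orth_proj W u \in W /\
  forall w, w \in W -> inner (u - orth_proj W u) w = 0.
Proof.
split; first exact: memv_pi.
have uE : u \in (W + perp W)%VS by rewrite perp_full memvf.
rewrite -{1}(daddv_pi_add (perp_disjoint W) uE) addrC addKr.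
exact/mem_orthovP/memv_pi.
Qed.

Definition equiangular_basis (a b : R) (v : n.-tuple 'rV[R]_n) : Prop :=
  [/\ basis_of fullv v,
      forall k, inner (tnth v k) (tnth v k) = a &
      forall k l, k != l -> inner (tnth v k) (tnth v l) = b].

Definition lattice (v : n.-tuple 'rV[R]_n) : set 'rV[R]_n :=
  [set x | inIntSpan v x].

End EuclideanSpace.

Section SuccessiveMinima.
Context {R : realType} {E : vectType R}.
Implicit Types S M Lam : set E.

Definition affine_hull S : set E :=
  [set x | exists (m : nat) (p : 'I_m -> E) (c : 'I_m -> R),
     [/\ forall k, S (p k), \sum_k c k = 1 & x = \sum_k c k *: p k]].

(* The dimension d of S is that of the direction U of its affine hull; the
   relation holds for no d when S is empty. *)
Definition affine_dim S (d : nat) : Prop :=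
  exists (x0 : E) (U : {vspace E}),
    affine_hull S = [set x0 + u | u in [set` U]] /\ \dim U = d.

Definition is_minimum (A : set R) (m : R) : Prop := A m /\ lbound A m.

(* [is_succ_min M Lam i l] says that the minimum defining lambda_i(M, Lam)
   exists and equals l. As affine dimension is intrinsic, M and Lam may lie in
   a proper linear subspace of E and be taken relative to it. *)
Definition is_succ_min M Lam (i : nat) (l : R) : Prop :=
  is_minimum
    [set t | 0 < t /\ exists2 d,
        affine_dim ([set t *: x | x in M] `&` Lam) d & (i <= d)%N] l.

End SuccessiveMinima.

(* Main.v *)
(* If v is (a,b)-equiangular then |sum c_k v_k|^2 = (a - b) S + b T^2, where
   S = sum c_k^2 and T = sum c_k.  For integral c <> 0 one has S >= 1,
   |T| <= S, T^2 <= n S and S = T modulo 2, which make this value at least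
   a = |v_k|^2, so that the v_k are n independent shortest lattice vectors.
   Projecting orthogonally to v_1, ..., v_j turns v_(j+1), ..., v_n into an
   equiangular family for ((a - b)(a + b j) / D, b (a - b) / D) with
   D = a + b (j - 1); these parameters satisfy the same hypotheses, so (ii)
   follows from the same argument. *)
Require Import Defs.
From mathcomp Require Import all_boot all_order all_algebra.
From mathcomp Require Import boolp classical_sets reals.
From mathcomp Require Import ring lra zify.

Set Implicit Arguments.
Unset Strict Implicit.
Unset Printing Implicit Defensive.

Import Order.TTheory GRing.Theory Num.Theory.

Local Open Scope ring_scope.
Local Open Scope classical_set_scope.

(** * Sums and sums of squares, and the lower bound for the Gram form *)

Lemma sqr_sum_le (R : realDomainType) m (c : 'I_m -> R) :
  (\sum_k c k) ^+ 2 <= m%:R * \sum_k c k ^+ 2.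
Proof.
case: m c => [|m] c; first by rewrite !big_ord0 mul0r expr0n.
set T := \sum_k c k; set S := \sum_k c k ^+ 2.
(* Cauchy-Schwarz against the all-ones vector: these are the deviations from the mean, scaled to
   avoid division. *)
have : 0 <= \sum_k (m.+1%:R * c k - T) ^+ 2 by apply: sumr_ge0 => k _; exact: sqr_ge0.
have -> : \sum_k (m.+1%:R * c k - T) ^+ 2 = m.+1%:R * (m.+1%:R * S - T ^+ 2).
  transitivity (\sum_k (m.+1%:R ^+ 2 * c k ^+ 2 - 2 * m.+1%:R * T * c k + T ^+ 2)).
    by apply: eq_bigr => k _; ring.
  rewrite !big_split /= sumrN -!mulr_sumr -/T -/S sumr_const card_ord -mulr_natl.
  by ring.
by rewrite pmulr_rge0 ?ltr0n // subr_ge0.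
Qed.

Lemma sum_le_sum_sqr m (c : 'I_m -> int) : `|\sum_k c k| <= \sum_k c k ^+ 2.
Proof.
apply: le_trans (ler_norm_sum _ _ _) _; apply: ler_sum => k _.
have [->|c0] := eqVneq (c k) 0; first by rewrite normr0 expr0n.
by rewrite -real_normK ?num_real // ler_eXnr // -gtz0_ge1 normr_gt0.
Qed.

Lemma sum_sqr_parity m (c : 'I_m -> int) :
  exists q, \sum_k c k ^+ 2 = \sum_k c k + 2 * q.
Proof.
have P (x : int) : exists q, x ^+ 2 = x + 2 * q.
  have [h [->|->]] : exists h, x = h * 2 \/ x = h * 2 + 1.
    by exists (x %/ 2)%Z; lia.
    by exists (h * (2 * h - 1)); ring.
  by exists (h * (2 * h + 1)); ring.
apply: (big_ind2 (fun x y => exists q, x = y + 2 * q)) => //.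
- by exists 0.
- by move=> x1 x2 y1 y2 [p ->] [q ->]; exists (p + q); ring.
Qed.

Lemma sum_sqr_ge1 m (c : 'I_m -> int) k : c k != 0 -> 1 <= \sum_k c k ^+ 2.
Proof.
move=> ck; rewrite (bigD1 k) //= ler_wpDr ?sumr_ge0 // => [l _|]; first exact: sqr_ge0.
by rewrite -gtz0_ge1 exprn_even_gt0.
Qed.

(** The rank is a parameter because the condition is used both for the given basis and for the
    smaller projected family. *)
Definition admissible (R : realFieldType) n (a b : R) :=
  (2 * b <= a /\ 0 <= 2 * b) \/ (- (n%:R * b) <= a /\ 0 <= - (n%:R * b)).

Lemma admissibleZ (R : realFieldType) n (a b t : R) :
  0 <= t -> admissible n a b -> admissible n (a * t) (b * t).
Proof.
move=> t0 [] [h1 h2]; [left|right]; split; nra.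
Qed.

(** The excess over [a] is [a * (S - 1) + b * (T ^+ 2 - S)], which is affine in [b], so it suffices
    that it is nonnegative at [b = 0], [b = a / 2] and [b = - a / m]. *)
Lemma gram_form_ge (R : realFieldType) m (a b : R) (c : 'I_m -> int) k :
  0 < a -> admissible m a b -> c k != 0 ->
  a <= (a - b) * (\sum_k c k ^+ 2)%:~R + b * (\sum_k c k)%:~R ^+ 2.
Proof.
move=> a_gt0 hab /sum_sqr_ge1.
have := sqr_sum_le c; have := sum_le_sum_sqr c; have [q] := sum_sqr_parity c.
set T := \sum_k c k; set S := \sum_k c k ^+ 2 => qE TS T2S S1.
rewrite -subr_ge0.
have -> : (a - b) * S%:~R + b * T%:~R ^+ 2 - a =
  a * (S - 1)%:~R + b * (T ^+ 2 - S)%:~R by rewrite !intrB rmorphXn; ring.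
case: hab => [[ba b0]|[mba mb0]].
- have [le_ST|lt_TS] := leP S (T ^+ 2).
    by rewrite addr_ge0 // mulr_ge0 ?ler0z ?subr_ge0 //; lra.
  (* The endpoint [b = a / 2]. If [T = 0], parity makes [S] even, so [S >= 2]; otherwise
     [S > T ^+ 2 >= 1]. *)
  have h : 0 <= S + T ^+ 2 - 2 by nia.
  have hR : 0 <= a * (S + T ^+ 2 - 2)%:~R :> R by rewrite mulr_ge0 ?ler0z // ltW.
  have h' : 0 <= (a - 2 * b) * (S - T ^+ 2)%:~R.
    by rewrite mulr_ge0 ?ler0z ?subr_ge0 // ltW.
  by move: hR h'; rewrite !intrB intrD; lra.
- have m_gt0 : 0 < (m%:R : R) by case: m k {c T S T2S qE TS S1 mba mb0} => [[]|].
  have b_le0 : b <= 0 by move: mb0; rewrite oppr_ge0 pmulr_rle0.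
  (* From [T^2 <= m S] if [m <= S], and otherwise from [T^2 <= S^2] and
     [0 <= (S - 1) (m - S)]. *)
  have h : 0 <= m%:Z * (S - 1) + S - T ^+ 2.
    rewrite natz in T2S.
    have [mS|Sm] := leP m%:Z S; first by lia.
    have : T ^+ 2 <= S ^+ 2 by nia.
    nia.
  have h1 : 0 <= (a + m%:R * b) * (S - 1)%:~R.
    by rewrite mulr_ge0 ?ler0z ?subr_ge0 //; lra.
  have h2 : 0 <= - b * (m%:Z * (S - 1) + S - T ^+ 2)%:~R.
    by rewrite mulr_ge0 ?ler0z // oppr_ge0.
  move: h1 h2; rewrite !(intrB, intrD, intrM) -pmulrn; lra.
Qed.

(** * Affine dimension and successive minima *)

Lemma affine_hull_span (R : realType) (E : vectType R) m (w : m.-tuple E) (S : set E) :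
  S 0 -> (forall k : 'I_m, S w`_k) -> S `<=` [set` <<w>>%VS] ->
  affine_hull S = [set` <<w>>%VS].
Proof.
move=> S0 Sw Ssub; apply/seteqP; split => x.
  move=> [k [p [c [Sp _ ->]]]]; apply: rpred_sum => i _; apply: rpredZ.
  exact: Ssub.
move=> /= /coord_span ->; set c := fun i => coord w i x.
(* The extra index [ord0] carries the point 0, whose weight brings the total to 1 without changing
   the combination. *)
exists m.+1, (fun k => oapp (fun i : 'I_m => w`_i) 0 (unlift ord0 k)).
exists (fun k => oapp c (1 - \sum_i c i) (unlift ord0 k)); split.
- by move=> k; case: (unlift ord0 k).
- rewrite big_ord_recl unlift_none /=.
  by rewrite [X in _ + X](eq_bigr c) ?subrK // => i _; rewrite liftK.
- rewrite big_ord_recl unlift_none /= scaler0 add0r.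
  by apply: eq_bigr => i _; rewrite liftK.
Qed.

Lemma affine_dim0 (R : realType) (E : vectType R) (S : set E) d :
  S `<=` [set 0] -> affine_dim S d -> d = 0%N.
Proof.
move=> S0 [x0 [U [hull <-]]]; apply/eqP; rewrite dimv_eq0 -subv0.
(* Every affine combination of points of [S] vanishes. Taking [u = 0] gives [x0 = 0], and then [U]
   is zero. *)
have sub u : u \in U -> x0 + u = 0.
  move=> uU; have : affine_hull S (x0 + u) by rewrite hull; exists u.
  move=> [k [p [c [Sp _ ->]]]]; apply: big1 => i _.
  by rewrite (S0 _ (Sp i)) scaler0.
apply/subvP => u uU; rewrite memv0 -[u](addKr x0) sub // addr0.
by rewrite -[x0]addr0 sub ?oppr0 ?mem0v.
Qed.

Section ShortBasis.
Variables (R : realType) (n m : nat) (w : m.-tuple 'rV[R]_n) (l : R).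
Hypotheses (l_gt0 : 0 < l) (free_w : free w).
Hypothesis w_min : forall x, inIntSpan w x -> x != 0 -> l <= enorm x.

Lemma inIntSpan_nth (k : 'I_m) : inIntSpan w w`_k.
Proof.
exists [ffun i => (i == k)%:R]; rewrite (bigD1 k) //= ffunE eqxx mulr1z.
by rewrite big1 ?addr0 // => i /negPf ik; rewrite ffunE ik mulr0z.
Qed.

(** All minima coincide: dilating by [l] captures the whole free family [w], while for [t < l] the
    points of [t *: M] have norm below [l], so 0 is the only lattice point among them. Asking only
    for [M] inside the unit ball covers the projected ball too. *)
Lemma is_succ_min_short_basis (M : set 'rV[R]_n) i :
  M `<=` unit_ball -> M 0 -> (forall k : 'I_m, M (l^-1 *: w`_k)) ->
  (1 <= i <= m)%N -> is_succ_min M [set x | inIntSpan w x] i l.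
Proof.
move=> M1 M0 Mw /andP[i1 im]; split.
  split=> //; exists m => //; exists 0, <<w>>%VS; split; last first.
    by apply/eqP; rewrite -[X in _ == X](size_tuple w) -/(free w).
  have -> : [set 0 + u | u in [set` <<w>>%VS]] = [set` <<w>>%VS].
    by under eq_imagel do rewrite add0r; rewrite image_id.
  apply: affine_hull_span => [|k|x].
  - split; first by exists 0; rewrite ?scaler0.
    by exists [ffun=> 0]; rewrite big1 // => k _; rewrite ffunE mulr0z.
  - split; last exact: inIntSpan_nth.
    by exists (l^-1 *: w`_k) => //; rewrite scalerA divff ?scale1r ?gt_eqF.
  - move=> [_ [c ->]]; apply: rpred_sum => k _; apply: rpredMz.
    by apply/memv_span/mem_nth; rewrite size_tuple.
move=> t [t_gt0 [d dim_d id_]]; rewrite leNgt; apply/negP => t_lt.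
suff d0 : d = 0%N by move: (leq_trans i1 id_); rewrite d0.
apply: affine_dim0 dim_d => _ [[y My <-] ty]; apply/eqP/contraT => ty0.
have := lt_le_trans t_lt (w_min ty ty0).
rewrite /enorm linearZl_LR linearZr_LR /= mulrA -expr2 sqrtrM ?sqr_ge0 //.
by rewrite sqrtr_sqr gtr0_norm // ltr_pMr // ltNge (M1 _ My).
Qed.

End ShortBasis.

(** * Equiangular families of arbitrary rank *)

Section Equiangular.
Variables (R : realType) (n m : nat) (a b : R) (w : m.-tuple 'rV[R]_n).
Hypothesis gram_w : forall k l : 'I_m, inner w`_k w`_l = (a - b) *+ (k == l) + b.

Lemma inner_comb_equiangular (c : 'I_m -> R) (l : 'I_m) :
  inner (\sum_k c k *: w`_k) w`_l = (a - b) * c l + b * \sum_k c k.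
Proof.
rewrite linear_sumlz /=.
transitivity (\sum_k ((a - b) * c k *+ (k == l) + b * c k)).
  apply: eq_bigr => k _; rewrite linearZl_LR /= gram_w mulrDr mulrnAr.
  by congr (_ *+ _ + _); rewrite mulrC.
rewrite big_split /= -mulr_sumr (bigD1 l) //= eqxx big1 ?addr0 // => k /negPf ->.
by rewrite mulr0n.
Qed.

Lemma normsq_comb_equiangular (c : 'I_m -> R) (x := \sum_k c k *: w`_k) :
  inner x x = (a - b) * (\sum_k c k ^+ 2) + b * (\sum_k c k) ^+ 2.
Proof.
rewrite {2}/x linear_sumr /= [(\sum_k c k) ^+ 2]expr2 mulrA.
rewrite [X in X + _]mulr_sumr [X in _ + X]mulr_sumr -big_split /=.
apply: eq_bigr => k _; rewrite linearZr_LR /= inner_comb_equiangular; ring.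
Qed.

(** Pairing a vanishing combination with each member of [w] gives [(a - b) * c l + b * T = 0], with
    [T] the sum of the coefficients. Summing over [l] forces [T = 0], and then each [c l = 0]. *)
Lemma free_equiangular :
  a - b != 0 -> ((0 < m)%N -> a + b * (m%:R - 1) != 0) -> free w.
Proof.
move=> ab0 abm0; apply/freeP => c cw0 l.
have cE k : (a - b) * c k + b * \sum_i c i = 0.
  by rewrite -inner_comb_equiangular cw0 linear0l.
have T0 : \sum_i c i = 0.
  have : \sum_k ((a - b) * c k + b * \sum_i c i) = 0 by rewrite big1.
  rewrite big_split /= -mulr_sumr sumr_const card_ord -mulr_natl => T0.
  have /eqP : (a + b * (m%:R - 1)) * \sum_i c i = 0 by rewrite -[RHS]T0; ring.
  by rewrite mulf_eq0 (negPf (abm0 _)) ?(leq_ltn_trans _ (ltn_ord l)) // => /eqP.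
by have /eqP := cE l; rewrite T0 mulr0 addr0 mulf_eq0 (negPf ab0) => /eqP.
Qed.

Lemma equiangular_min x : 0 < a -> admissible m a b ->
  inIntSpan w x -> x != 0 -> Num.sqrt a <= enorm x.
Proof.
move=> a_gt0 hab [c ->] x0; rewrite ler_wsqrtr //.
have [/forallP c0|] := boolP [forall k, c k == 0].
  by case/eqP: x0; apply: big1 => k _; rewrite (eqP (c0 k)) mulr0z.
rewrite negb_forall => /existsP[k ck].
rewrite (eq_bigr (fun k => (c k)%:~R *: w`_k)) => [|i _]; last by rewrite scaler_int.
rewrite normsq_comb_equiangular; apply: le_trans (gram_form_ge a_gt0 hab ck) _.
rewrite !rmorph_sum /= lerD2r (eq_bigr (fun k => (c k)%:~R ^+ 2)) // => i _.
by rewrite rmorphXn.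
Qed.

Lemma is_succ_min_equiangular (M : set 'rV[R]_n) i :
  0 < a -> admissible m a b ->
  M `<=` unit_ball -> M 0 -> (forall k : 'I_m, M ((Num.sqrt a)^-1 *: w`_k)) ->
  (1 <= i <= m)%N -> is_succ_min M [set x | inIntSpan w x] i (Num.sqrt a).
Proof.
move=> a_gt0 hab M1 M0 Mw im.
have m_gt0 : (0 < m)%N by lia.
have [ab_gt0 abm_gt0] : 0 < a - b /\ 0 < a + b * (m%:R - 1).
  have m1 : 1 <= (m%:R : R) by rewrite ler1n.
  case: hab => [] [h1 h2]; first by split; nra.
  (* Here [a + b * (m - 1)] is [(a + m * b) - b]: positive if [b < 0], and equal to [a] if
     [b = 0]. *)
  by have [->|/lt_total/orP[]] := eqVneq b 0; split; nra.
apply: is_succ_min_short_basis => //; first by rewrite sqrtr_gt0.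
  by apply: free_equiangular; rewrite ?gt_eqF.
by move=> x; exact: equiangular_min.
Qed.

End Equiangular.

(** * Orthogonal projections *)

Section OrthogonalProjection.
Variables (R : realType) (n : nat).
Implicit Types (u : 'rV[R]_n) (L W : {vspace 'rV[R]_n}).

Lemma inner_sym u1 u2 : inner u1 u2 = inner u2 u1.
Proof. by apply: eq_bigr => k _; rewrite mulrC. Qed.

(** Pythagoras; this keeps the projected ball inside the unit ball. *)
Lemma enorm_orth_proj W u : enorm (orth_proj W u) <= enorm u.
Proof.
have [PuW uPu] := orth_projP W u; rewrite ler_wsqrtr //.
have uE := subrK (orth_proj W u) u.
move: (orth_proj W u) (u - _) PuW uPu uE => p q pW /(_ p pW) qp <-.
rewrite linearDl !linearDr /= [inner p q]inner_sym qp addr0 add0r.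
by rewrite lerDr; have [->|/inner_gt0/ltW//] := eqVneq q 0; rewrite linear0l.
Qed.

Lemma orth_proj_id W u : u \in W -> orth_proj W u = u.
Proof. exact: daddv_pi_id (perp_disjoint W). Qed.

Lemma orth_proj_perp L u : u \in L -> orth_proj (perp L) u = 0.
Proof.
move=> uL; have [PuL uPu] := orth_projP (perp L) u.
apply: contraTeq isT => /inner_gt0; have := uPu _ PuL.
rewrite linearBl /= [inner u _]inner_sym (mem_orthovP PuL) // sub0r => /eqP.
by rewrite oppr_eq0 => /eqP ->; rewrite ltxx.
Qed.

End OrthogonalProjection.

(** * Projecting away the first [j] vectors *)

Section ProjectedEquiangular.
Variables (R : realType) (j m : nat) (a b : R).
Variable v : (j + m).-tuple 'rV[R]_(j + m).
Hypothesis gram_v : forall k l : 'I_(j + m),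
  inner v`_k v`_l = (a - b) *+ (k == l) + b.
Hypothesis den_neq0 : a + b * (j%:R - 1) != 0.

Let L := <<take j v>>%VS.
Let P := orth_proj (perp L).
(** Each of the first [j] vectors has inner product [a + b * (j - 1)] with [s] and [b] with any
    later vector; the ratio [c] makes a later vector minus [c *: s] orthogonal to [L]. *)
Let c := b / (a + b * (j%:R - 1)).
Let s := \sum_(l < j) v`_l.

Definition projected_basis : m.-tuple 'rV[R]_(j + m) :=
  [tuple P v`_(j + k) | k < m].

Lemma nth_projected_basis (k : 'I_m) : projected_basis`_k = P v`_(j + k).
Proof. by rewrite -tnth_nth tnth_mktuple. Qed.

Lemma mem_take_span (l : 'I_j) : v`_l \in L.
Proof.
apply: memv_span; rewrite -(nth_take _ (ltn_ord l)) mem_nth //.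
by rewrite size_takel ?size_tuple ?leq_addr.
Qed.

Lemma inner_take_sum (l : 'I_(j + m)) :
  inner s v`_l = (a - b) *+ (l < j) + b * j%:R.
Proof.
rewrite linear_sumlz /=.
rewrite (eq_bigr (fun k : 'I_j => (a - b) *+ (k == l :> nat) + b)) => [|k _].
  rewrite big_split /= sumr_const card_ord mulr_natr; congr (_ + _).
  case: ltnP => [lj|jl].
    rewrite (bigD1 (Ordinal lj)) //= eqxx big1 ?addr0 // => k.
    by rewrite -val_eqE /= => /negPf ->.
  by rewrite big1 // => k _; rewrite ltn_eqF // (leq_trans (ltn_ord k)).
exact: (gram_v (lshift m k) l).
Qed.

(* By the symmetry of the Gram matrix, the component of [v`_(j + k)] in [L] is
   a multiple of the sum of the spanning vectors. *)
Lemma orth_proj_equiangular (k : 'I_m) : P v`_(j + k) = v`_(j + k) - c *: s.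
Proof.
have sL : s \in L by apply: rpred_sum => l _; exact: mem_take_span.
have uv (l : 'I_j) : inner (v`_(j + k) - c *: s) v`_l = 0.
  rewrite linearBl linearZl_LR /= (inner_take_sum (lshift m l)) /= ltn_ord.
  rewrite (gram_v (rshift j k) (lshift m l)) eq_rlshift mulr0n mulr1n /c.
  by field.
have uL : v`_(j + k) - c *: s \in perp L.
  apply/mem_orthovP => x /coord_span ->; rewrite linear_sumr big1 // => i _.
  have ij : (i < j)%N by rewrite (leq_trans (ltn_ord i)) ?geq_minl.
  by rewrite linearZr_LR /= nth_take // (uv (Ordinal ij)) mulr0.
rewrite -[RHS](orth_proj_id uL) /P linearB linearZ /= [orth_proj _ s]orth_proj_perp //.
by rewrite scaler0 subr0.
Qed.

(** Since projected vectors are orthogonal to [s], only one correction term survives: the original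
    inner product drops by [c * (b * j)], and [b - c * (b * j)] equals [b']. *)
Lemma gram_projected_basis (k l : 'I_m)
    (a' := (a - b) * (a + b * j%:R) / (a + b * (j%:R - 1)))
    (b' := b * (a - b) / (a + b * (j%:R - 1))) :
  inner projected_basis`_k projected_basis`_l = (a' - b') *+ (k == l) + b'.
Proof.
have sP : inner s (P v`_(j + l)) = 0.
  rewrite inner_sym; have /mem_orthovP -> // : P v`_(j + l) \in perp L by exact: memv_pi.
  by apply: rpred_sum => i _; exact: mem_take_span.
rewrite !nth_projected_basis [P v`_(j + k)]orth_proj_equiangular linearBl linearZl_LR /=.
rewrite sP mulr0 subr0 orth_proj_equiangular linearBr linearZr_LR /= [inner _ s]inner_sym.
rewrite (inner_take_sum (rshift j k)) (gram_v (rshift j k) (rshift j l)) eq_rshift.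
have -> : a' - b' = a - b by rewrite /a' /b'; field.
rewrite /= ltnNge leq_addr mulr0n add0r -addrA; congr (_ + _).
by rewrite /b' /c; field.
Qed.

(** The first [j] generators project to 0; conversely, integer coefficients lift by setting the
    first [j] to zero. *)
Lemma lattice_orth_proj :
  P @` lattice v = [set x | inIntSpan projected_basis x].
Proof.
apply/seteqP; split=> x.
  move=> [_ [z ->] <-]; exists [ffun k => z (rshift j k)].
  rewrite linear_sum big_split_ord /= big1 ?add0r => [|l _]; last first.
    by rewrite raddfMz /= orth_proj_perp ?mul0rz // mem_take_span.
  by apply: eq_bigr => k _; rewrite nth_projected_basis ffunE raddfMz.
move=> [z ->]; exists (\sum_(k < m) v`_(j + k) *~ z k).
  exists [ffun k => if split k is inr k' then z k' else 0].
  rewrite big_split_ord /= [X in _ = X + _]big1 ?add0r => [|l _].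
    apply: eq_bigr => k _; rewrite ffunE.
    by rewrite (_ : split _ = inr k) //; exact: (unsplitK (inr k)).
  rewrite ffunE (_ : split _ = inl l) ?mulr0z //; exact: (unsplitK (inl l)).
by rewrite linear_sum; apply: eq_bigr => k _; rewrite nth_projected_basis raddfMz.
Qed.

End ProjectedEquiangular.

Theorem proposition5p3 (R : realType) (n : nat) (a b : R)
    (v : n.-tuple 'rV[R]_n)
    (a_gt0 : 0 < a)
    (hab : (2 * b <= a /\ 0 <= 2 * b) \/
           (- (n%:R * b) <= a /\ 0 <= - (n%:R * b)))
    (hv : equiangular_basis a b v) :
  (forall i : nat, (1 <= i <= n)%N ->
     is_succ_min unit_ball (lattice v) i (Num.sqrt a)) /\
  (forall j : nat, (1 <= j < n)%N ->
     let W := perp <<take j v>>%VS in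
     forall i : nat, (1 <= i <= n - j)%N ->
       is_succ_min (orth_proj W @` unit_ball) (orth_proj W @` lattice v) i
         (Num.sqrt (((a - b) * (a + b * j%:R)) / (a + b * (j%:R - 1))))).
Proof.
have gram_v (k l : 'I_n) : inner v`_k v`_l = (a - b) *+ (k == l) + b.
  case: hv => _ vv vw; rewrite -!tnth_nth.
  by have [->|kl] := eqVneq k l; rewrite ?vv ?vw // ?subrK ?add0r.
have unit_ball0 p : unit_ball (0 : 'rV[R]_p).
  by rewrite /unit_ball /= /enorm linear0l sqrtr0.
have unit_ballV p (u : 'rV[R]_p) (r : R) :
    inner u u = r -> 0 < r -> unit_ball ((Num.sqrt r)^-1 *: u).
  move=> ur r_gt0; rewrite /unit_ball /= /enorm linearZl_LR linearZr_LR /= ur mulrA.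
  by rewrite -invfM -expr2 sqr_sqrtr ?(ltW r_gt0) // mulVf ?sqrtr1 ?lexx // gt_eqF.
split=> [i i_n|j /andP[j_gt0 j_lt] W i i_nj].
  apply: (is_succ_min_equiangular gram_v) => // k.
  by apply: unit_ballV => //; rewrite gram_v eqxx subrK.
(* Writing [n] as [j + m] lets the indices split into the projected-away block and the surviving
   one. *)
have [m n_jm] : exists m, n = (j + m)%N by exists (n - j)%N; lia.
move: n_jm v hab hv gram_v j_lt @W i_nj => ->.
move=> v hab _ gram_v; rewrite addKn => j_lt W i_m.
have m_gt0 : 0 < (m%:R : R) by rewrite ltr0n; lia.
have j_ge1 : 1 <= (j%:R : R) by rewrite ler1n.
rewrite natrD in hab.
have [ab_gt0 den_gt0 num_gt0] :
    [/\ 0 < a - b, 0 < a + b * (j%:R - 1) & 0 < a + b * j%:R].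
  case: hab => [] [h1 h2]; first by split; nra.
  by have [->|/lt_total/orP[]] := eqVneq b 0; split; nra.
have gram_w := gram_projected_basis gram_v (lt0r_neq0 den_gt0).
rewrite (lattice_orth_proj v).
apply: (is_succ_min_equiangular gram_w) => //.
- by rewrite divr_gt0 ?mulr_gt0.
(* Both projected parameters share the positive factor [(a - b) / (a + b * (j - 1))]. Without it
   they are [a + b * j] and [b], and [- (m * b) <= a + b * j] is the original bound for rank
   [j + m]. *)
- rewrite [(a - b) * _]mulrC -!mulrA; apply: admissibleZ.
    by rewrite divr_ge0 ?ltW.
  by case: hab => [] [h1 h2]; [left|right]; split; nra.
- by move=> _ [u u1 <-]; exact: le_trans (enorm_orth_proj _ _) u1.
- by exists 0; rewrite ?linear0.
(* The normalised projected vector is its own preimage: it is a unit vector already lying in [W]. *)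
- move=> k; set r := Num.sqrt _; exists (r^-1 *: (projected_basis v)`_k).
    apply: unit_ballV; last by rewrite divr_gt0 ?mulr_gt0.
    by rewrite gram_w eqxx mulr1n subrK.
  rewrite linearZ /= orth_proj_id // nth_projected_basis; exact: memv_pi.
Qed.
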